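(* Let $A, B, S \in \mathbb{R}^{n\times n}$ and let $T>0$. Then the matrix $$Q=\int_0^{T}e^{A \tau}\,S\, e^{B\tau}\, d\tau$$ satisfies the Sylvester equation $$AQ+QB = -S+e^{A T}\,S\, e^{B T}.$$
   Context: Here $e^{M}$ denotes the matrix exponential, and the integral of a matrix-valued function is taken entrywise. No spectral or stability assumption is made on $A$ or $B$. *)

(* Defs.v *)
From HB Require Import structures.
From mathcomp Require Import all_boot all_order all_algebra.
From mathcomp Require Import all_classical all_reals all_analysis.
Import Order.TTheory GRing.Theory Num.Theory.
Import numFieldNormedType.Exports.

Set Implicit Arguments.
Unset Strict Implicit.
Unset Printing Implicit Defensive.

Local Open Scope classical_set_scope.
Local Open Scope ring_scope.

(* Sum of the series of M ^+ k / k!; the limit is taken in the max-norm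
   topology of 'M[R]_n, where this series converges for every M. *)
Definition expmx (R : realType) (n : nat) (M : 'M[R]_n) : 'M[R]_n :=
  limn (series (fun k : nat => (k`!%:R)^-1 *: M ^+ k)).

Definition mxintegral (R : realType) (m n : nat) (a b : R)
    (F : R -> 'M[R]_(m, n)) : 'M[R]_(m, n) :=
  \matrix_(i, j) \int[@lebesgue_measure R]_(t in `[a, b]) F t i j.

(* Main.v *)
(* With F t = e^{A t} S e^{B t}, the product rule gives F' = A F + F B, so
   integrating over [0, T] yields A Q + Q B = F T - F 0.  The derivative of
   the exponential is obtained entrywise: each entry of e^{t M} is a real power
   series in t, dominated by an exponential series. *)
Require Import Defs.
From HB Require Import structures.
From mathcomp Require Import all_boot all_order all_algebra.
From mathcomp Require Import all_classical all_reals all_analysis.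
Import Order.TTheory GRing.Theory Num.Theory.
Import numFieldNormedType.Exports.

Set Implicit Arguments.
Unset Strict Implicit.
Unset Printing Implicit Defensive.

Local Open Scope classical_set_scope.
Local Open Scope ring_scope.

(** * Entrywise limits of matrix sequences *)

Lemma cvg_mxP (R : realType) (m n : nat) (u : nat -> 'M[R]_(m, n))
    (L : 'M[R]_(m, n)) :
  u @ \oo --> L <-> forall i j, u k i j @[k --> \oo] --> L i j.
Proof.
split=> [uL i j|uL].
  apply: (@cvg_comp _ _ _ u (fun M : 'M[R]_(m, n) => M i j) _ _ _ uL).
  exact: coord_continuous.
apply/cvg_mx_entourageP => A entA.
(* There are finitely many indices, so eventual closeness of each entry gives eventual closeness of
   all entries at once. *)
apply: filter_forall => i; apply: filter_forall => j.
have /cvg_app_entourageP /(_ A entA) := uL i j.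
by apply: filterS => k; exact: mem_set.
Qed.

Lemma cvg_mulmxl (R : realType) (m n p : nat) (N : 'M[R]_(m, n))
    (u : nat -> 'M[R]_(n, p)) (L : 'M[R]_(n, p)) :
  u @ \oo --> L -> N *m u k @[k --> \oo] --> N *m L.
Proof.
move=> /cvg_mxP uL; apply/cvg_mxP => i j.
under eq_fun do rewrite mxE.
rewrite mxE; apply: cvg_big => [|l _]; first exact: add_continuous.
exact: cvgMl_tmp (uL l j).
Qed.
Arguments cvg_mulmxl {R m n p} N {u L}.

Lemma cvg_mulmxr (R : realType) (m n p : nat) (N : 'M[R]_(n, p))
    (u : nat -> 'M[R]_(m, n)) (L : 'M[R]_(m, n)) :
  u @ \oo --> L -> u k *m N @[k --> \oo] --> L *m N.
Proof.
move=> /cvg_mxP uL; apply/cvg_mxP => i j.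
under eq_fun do rewrite mxE.
rewrite mxE; apply: cvg_big => [|l _]; first exact: add_continuous.
exact: cvgMr_tmp (uL i l).
Qed.
Arguments cvg_mulmxr {R m n p} N {u L}.

(** * Convergence and algebra of the exponential series *)

Lemma norm_expr_mx_le (R : realType) (n : nat) (M : 'M[R]_n) k i j :
  `|(M ^+ k) i j| <= (\sum_a \sum_b `|M a b|) ^+ k.
Proof.
elim: k i j => [|k IHk] i j.
  by rewrite !expr0 mxE; case: eqP => _; rewrite ?normr1 ?normr0.
rewrite exprS -mulmxE mxE; apply: le_trans (ler_norm_sum _ _ _) _.
rewrite exprS; apply: (@le_trans _ _
  ((\sum_b `|M i b|) * (\sum_a \sum_b `|M a b|) ^+ k)).
  rewrite mulr_suml; apply: ler_sum => b _.
  by rewrite normrM ler_wpM2l.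
apply: ler_wpM2r.
  by apply: exprn_ge0; apply: sumr_ge0 => a _; apply: sumr_ge0.
(* Row [i] contributes one term of the double sum, and the other rows are nonnegative. *)
rewrite [leRHS](bigD1 i)//= lerDl.
by apply: sumr_ge0 => a _; apply: sumr_ge0.
Qed.

(* The left factor N makes this family of power series stable under formal
   differentiation, which replaces N by N *m M. *)
Lemma is_cvg_pseries_mx (R : realType) (n : nat) (N M : 'M[R]_n) i j (x : R) :
  cvgn (pseries (fun k => (k`!%:R)^-1 * (N *m M ^+ k) i j) x).
Proof.
pose s := \sum_a \sum_b `|M a b|; pose C := \sum_l `|N i l|.
have s0 : 0 <= s by apply: sumr_ge0 => a _; apply: sumr_ge0.
have C0 : 0 <= C by apply: sumr_ge0.
have NMle k : `|(N *m M ^+ k) i j| <= C * s ^+ k.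
  rewrite mxE; apply: le_trans (ler_norm_sum _ _ _) _.
  rewrite mulr_suml; apply: ler_sum => l _.
  by rewrite normrM ler_wpM2l// norm_expr_mx_le.
apply: normed_cvg; rewrite /normed_series_of /=.
(* Absolute convergence by comparison: the [k]-th term is at most [C * (s * |x|) ^ k / k!], the
   general term of a scalar exponential series. *)
apply: (@series_le_cvg _ _ (C *: exp_coeff (s * `|x|))) => [k|k|k|].
- exact: normr_ge0.
- by rewrite mulr_ge0// exp_coeff_ge0// mulr_ge0.
- rewrite !normrM normfV normr_nat normrX.
  have -> : (C *: exp_coeff (s * `|x|)) k =
      (k`!%:R)^-1 * (C * s ^+ k) * `|x| ^+ k.
    transitivity (C * ((s * `|x|) ^+ k / k`!%:R)) => //.
    by rewrite exprMn -[RHS]mulrA [RHS]mulrC !mulrA.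
  by rewrite ler_wpM2r ?exprn_ge0// ler_wpM2l// invr_ge0.
- by apply: is_cvg_seriesZ; exact: is_cvg_series_exp_coeff.
Qed.

(** The factor [k + 1] cancels against [(k + 1)!], and the extra [M] in [M ^+ k.+1] is absorbed into
    the left factor. *)
Lemma pseries_diffs_mx (R : realType) (n : nat) (N M : 'M[R]_n) i j :
  pseries_diffs (fun k => (k`!%:R)^-1 * (N *m M ^+ k) i j) =
  (fun k => (k`!%:R)^-1 * (N *m M *m M ^+ k) i j) :> (nat -> R).
Proof.
apply/funext => k; rewrite /pseries_diffs factS natrM invfM !mulrA.
by rewrite mulfV ?mul1r// exprS -mulmxE mulmxA.
Qed.

Lemma expr_scalemx (R : comPzRingType) (n : nat) (t : R) (M : 'M[R]_n) k :
  (t *: M) ^+ k = t ^+ k *: M ^+ k.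
Proof.
elim: k => [|k IHk]; first by rewrite !expr0 scale1r.
by rewrite !exprS IHk -!mulmxE -scalemxAl -scalemxAr scalerA.
Qed.

(** Places the entries of the exponential series in the family of power series above, with left
    factor [1%:M]. *)
Lemma series_expmx_coord (R : realType) (n : nat) (M : 'M[R]_n) (t : R) i j :
  (fun k => series (fun k : nat => (k`!%:R)^-1 *: (t *: M) ^+ k) k i j) =
  pseries (fun k => (k`!%:R)^-1 * (1%:M *m M ^+ k) i j) t.
Proof.
apply/funext => k; rewrite /pseries /series /= summxE.
apply: eq_bigr => l _.
by rewrite mul1mx expr_scalemx !mxE mulrA mulrAC.
Qed.

Lemma is_cvg_series_expmx (R : realType) (n : nat) (M : 'M[R]_n) :
  cvgn (series (fun k : nat => (k`!%:R)^-1 *: M ^+ k)).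
Proof.
apply/cvg_ex; exists (\matrix_(i, j)
  limn (pseries (fun k => (k`!%:R)^-1 * (1%:M *m M ^+ k) i j) (1 : R))).
apply/cvg_mxP => i j; rewrite mxE.
have := series_expmx_coord M 1 i j; rewrite scale1r => ->.
exact: is_cvg_pseries_mx.
Qed.

(** [limn] is informative only for a convergent sequence; this fact is what gives access to the
    definition of [expmx]. *)
Lemma cvg_series_expmx (R : realType) (n : nat) (M : 'M[R]_n) :
  series (fun k : nat => (k`!%:R)^-1 *: M ^+ k) @ \oo --> expmx M.
Proof. exact: is_cvg_series_expmx. Qed.
Arguments cvg_series_expmx {R n} M.

Lemma expmx_coord (R : realType) (n : nat) (M : 'M[R]_n) (t : R) i j :
  expmx (t *: M) i j =
  limn (pseries (fun k => (k`!%:R)^-1 * (1%:M *m M ^+ k) i j) t).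
Proof.
apply/esym/cvg_lim => //; rewrite -series_expmx_coord.
by move: i j; apply/cvg_mxP; exact: cvg_series_expmx.
Qed.

(** [N] commutes with every partial sum, so [N *m expmx M] and [expmx M *m N] are limits of the same
    sequence. *)
Lemma expmx_comm (R : realType) (n : nat) (N M : 'M[R]_n) :
  comm_mx N M -> comm_mx N (expmx M).
Proof.
move=> NM; have cE := cvg_series_expmx M.
rewrite /comm_mx -(cvg_lim _ (cvg_mulmxl N cE))//; apply: cvg_lim => //.
rewrite (_ : (fun k => _) =
    fun k => series (fun k : nat => (k`!%:R)^-1 *: M ^+ k) k *m N).
  exact: cvg_mulmxr.
apply/funext => k; rewrite /series /= mulmx_sumr mulmx_suml.
apply: eq_bigr => l _; rewrite -scalemxAr -scalemxAl; congr (_ *: _).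
exact: commrX.
Qed.

Lemma expmx0 (R : realType) (n : nat) : expmx (0 : 'M[R]_n) = 1%:M.
Proof.
(* The partial sum of index 0 is empty, hence 0; from index 1 on, the partial sums are constantly
   the identity, hence the shift. *)
apply/cvg_lim => //; rewrite -cvg_shiftS.
apply: cvg_near_cst; apply: nearW => k.
rewrite /series /= big_nat_recl// fact0 invr1 scale1r expr0 big1 ?addr0// => l _.
by rewrite exprS mul0r scaler0.
Qed.

(** * Differentiation of the exponential and of matrix products *)

Lemma is_derive_expmx (R : realType) (n : nat) (M : 'M[R]_n) (t : R) i j :
  is_derive t 1 (fun t => expmx (t *: M) i j) ((M *m expmx (t *: M)) i j).
Proof.
rewrite (_ : (fun t => _) =
  fun t => limn (pseries (fun k => (k`!%:R)^-1 * (1%:M *m M ^+ k) i j) t));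
  last by apply/funext => u; exact: expmx_coord.
(* The formally differentiated series has left factor [1%:M *m M]; its partial sums are the entries
   of [M] times the partial sums of the exponential. *)
rewrite (_ : (M *m expmx (t *: M)) i j = limn (pseries (pseries_diffs
  (fun k => (k`!%:R)^-1 * (1%:M *m M ^+ k) i j)) t)); last first.
  apply/esym/cvg_lim => //; rewrite pseries_diffs_mx.
  have /cvg_mxP/(_ i j) := cvg_mulmxl M (cvg_series_expmx (t *: M)).
  rewrite (_ : (fun k => _) =
      pseries (fun k => (k`!%:R)^-1 * (1%:M *m M *m M ^+ k) i j) t) //.
  apply/funext => k.
  rewrite /series /pseries /= mulmx_sumr summxE; apply: eq_bigr => l _.
  by rewrite mul1mx expr_scalemx -!scalemxAr !mxE mulrA mulrAC.
(* Termwise differentiation at [t] asks that the series and its first two formal derivatives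
   converge at a point of larger absolute value; all three belong to the family, and [|t| + 1] is
   such a point. *)
apply: (@pseries_snd_diffs _ _ (`|t| + 1)); rewrite ?pseries_diffs_mx;
  try exact: is_cvg_pseries_mx.
by rewrite [ltRHS]ger0_norm ?addr_ge0// ltrDl.
Qed.

Lemma is_derive_mulmx (R : realType) (m n p : nat) (F : R -> 'M[R]_(m, n))
    (G : R -> 'M[R]_(n, p)) (dF : 'M[R]_(m, n)) (dG : 'M[R]_(n, p)) (t : R) :
    (forall i j, is_derive t 1 (fun s => F s i j) (dF i j)) ->
    (forall i j, is_derive t 1 (fun s => G s i j) (dG i j)) ->
  forall i j,
    is_derive t 1 (fun s => (F s *m G s) i j) ((dF *m G t + F t *m dG) i j).
Proof.
move=> hF hG i j.
rewrite (_ : (fun s => _) =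
    \sum_l (fun s => F s i l) * (fun s => G s l j)); last first.
  by apply/funext => s; rewrite mxE fct_sumE.
rewrite !mxE -big_split /=.
apply: is_derive_sum => l; rewrite addrC [dF _ _ * _]mulrC.
exact: is_deriveM.
Qed.

(** * Entrywise integration: the fundamental theorem of calculus and linearity *)

Lemma mxintegral_deriv (R : realType) (m n : nat) (a b : R)
    (F dF : R -> 'M[R]_(m, n)) : a < b ->
    (forall (t : R) i j, is_derive t 1 (fun s => F s i j) (dF t i j)) ->
    (forall i j, continuous (fun t => dF t i j)) ->
  mxintegral a b dF = F b - F a.
Proof.
move=> ab hF cdF; apply/matrixP => i j; rewrite !mxE.
have cF : continuous (fun t => F t i j).
  move=> t; apply: differentiable_continuous; apply/derivable1_diffP.
  by have [] := hF t i j.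
rewrite /Rintegral (@continuous_FTC2 _ _ (fun t => F t i j))//.
- exact: continuous_subspaceT.
- split=> [x _||]; first by have [] := hF x i j.
  + exact/cvg_at_right_filter/cF.
  + exact/cvg_at_left_filter/cF.
- by move=> t _; rewrite derive1E; have [_] := hF t i j.
Qed.

Lemma continuous_itv_integrable (R : realType) (a b : R) (f : R -> R) :
  continuous f -> (@lebesgue_measure R).-integrable `[a, b] (EFin \o f).
Proof.
move=> cf; apply: continuous_compact_integrable; first exact: segment_compact.
exact: continuous_subspaceT.
Qed.

(** Entries of a matrix product are finite sums, so this is what lets a constant matrix factor leave
    the integral. Continuity supplies the integrability that additivity requires. *)
Lemma Rintegral_sum_continuous (R : realType) (a b : R) (I : Type) (r : seq I)
    (f : I -> R -> R) : (forall i, continuous (f i)) ->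
  \int[@lebesgue_measure R]_(t in `[a, b]) (\sum_(i <- r) f i t) =
  \sum_(i <- r) \int[@lebesgue_measure R]_(t in `[a, b]) f i t.
Proof.
move=> cf; elim: r => [|i r IHr].
  rewrite big_nil; under eq_Rintegral do rewrite big_nil.
  by rewrite Rintegral_cst// mul0r.
rewrite big_cons -IHr; under eq_Rintegral do rewrite big_cons.
rewrite RintegralD//; first exact: continuous_itv_integrable.
apply: continuous_itv_integrable => t.
by apply: cvg_big => [|l _]; [exact: add_continuous|exact: cf].
Qed.

Lemma mxintegralD (R : realType) (m n : nat) (a b : R)
    (F G : R -> 'M[R]_(m, n)) :
    (forall i j, continuous (fun t => F t i j)) ->
    (forall i j, continuous (fun t => G t i j)) ->
  mxintegral a b (fun t => F t + G t) = mxintegral a b F + mxintegral a b G.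
Proof.
move=> cF cG; apply/matrixP => i j; rewrite !mxE.
rewrite -RintegralD//; try exact: continuous_itv_integrable.
by apply: eq_Rintegral => t _; rewrite mxE.
Qed.

Lemma mxintegral_mulmxl (R : realType) (m n p : nat) (a b : R)
    (N : 'M[R]_(m, n)) (F : R -> 'M[R]_(n, p)) :
    (forall i j, continuous (fun t => F t i j)) ->
  mxintegral a b (fun t => N *m F t) = N *m mxintegral a b F.
Proof.
move=> cF; apply/matrixP => i j; rewrite !mxE.
under eq_Rintegral do rewrite mxE.
rewrite Rintegral_sum_continuous => [|l t]; last exact: (cvgMl_tmp (cF l j t)).
apply: eq_bigr => l _; rewrite mxE RintegralZl//.
exact: continuous_itv_integrable.
Qed.

Lemma mxintegral_mulmxr (R : realType) (m n p : nat) (a b : R)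
    (N : 'M[R]_(n, p)) (F : R -> 'M[R]_(m, n)) :
    (forall i j, continuous (fun t => F t i j)) ->
  mxintegral a b (fun t => F t *m N) = mxintegral a b F *m N.
Proof.
move=> cF; apply/matrixP => i j; rewrite !mxE.
under eq_Rintegral do rewrite mxE.
rewrite Rintegral_sum_continuous => [|l t]; last exact: (cvgMr_tmp (cF i l t)).
apply: eq_bigr => l _; rewrite mxE RintegralZr//.
exact: continuous_itv_integrable.
Qed.

Lemma continuous_mulmx (R : realType) (m n p : nat)
    (F : R -> 'M[R]_(m, n)) (G : R -> 'M[R]_(n, p)) :
    (forall i j, continuous (fun t => F t i j)) ->
    (forall i j, continuous (fun t => G t i j)) ->
  forall i j, continuous (fun t => (F t *m G t) i j).
Proof.
move=> cF cG i j; under [X in continuous X]eq_fun do rewrite mxE.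
move=> t; apply: cvg_big => [|l _]; first exact: add_continuous.
by apply: cvgM; [exact: cF|exact: cG].
Qed.

Theorem lemma3 (R : realType) (n : nat) (A B S : 'M[R]_n) (T : R) (hT : 0 < T) :
  let Q : 'M[R]_n :=
    mxintegral 0 T (fun t : R => expmx (t *: A) *m S *m expmx (t *: B)) in
  A *m Q + Q *m B = - S + expmx (T *: A) *m S *m expmx (T *: B).
Proof.
set F := fun t : R => expmx (t *: A) *m S *m expmx (t *: B).
have dF (t : R) i j : is_derive t 1 (fun s => F s i j) ((A *m F t + F t *m B) i j).
  have dES a b : is_derive t 1 (fun s => (expmx (s *: A) *m S) a b)
      ((A *m expmx (t *: A) *m S) a b).
    (* The constant [S] is treated as a function with derivative the zero matrix, so that the
       product rule applies to it. *)
    have dS c d : is_derive t 1 (fun=> S c d) ((0 : 'M[R]_n) c d).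
      by rewrite mxE; exact: is_derive_cst.
    by have := is_derive_mulmx (is_derive_expmx A t) dS a b;
      rewrite mulmx0 addr0.
  (* Differentiation puts [B] to the left of its exponential, whereas [Q *m B] has it on the
     right. *)
  have BE : B *m expmx (t *: B) = expmx (t *: B) *m B.
    by apply: expmx_comm; rewrite /comm_mx -scalemxAr -scalemxAl.
  have := is_derive_mulmx dES (is_derive_expmx B t) i j.
  by rewrite BE /F !mulmxA.
have cF i j : continuous (fun t => F t i j).
  move=> t; apply: differentiable_continuous; apply/derivable1_diffP.
  by have [] := dF t i j.
have cAF i j : continuous (fun t => (A *m F t) i j).
  by apply: continuous_mulmx => // a b t; exact: cvg_cst.
have cFB i j : continuous (fun t => (F t *m B) i j).
  by apply: continuous_mulmx => // a b t; exact: cvg_cst.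
(* The left side becomes the single integral of [A *m F t + F t *m B], which is the derivative of
   [F]. *)
move=> Q; rewrite -mxintegral_mulmxl// -mxintegral_mulmxr// -mxintegralD//.
rewrite (mxintegral_deriv hT dF) => [|i j t].
  (* Both exponentials are the identity at time 0, so [F 0] is [S]. *)
  by rewrite /F !scale0r !expmx0 mul1mx mulmx1 addrC.
under eq_fun do rewrite mxE; apply: cvgD; [exact: cAF|exact: cFB].
Qed.
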